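(* Let $\boldsymbol{x}_1,\dots,\boldsymbol{x}_T\in\mathbb{R}^{N_x}$ and $y_1,\dots,y_T\in\mathbb{R}$ be data ($T\ge 1$), fix $\boldsymbol{\theta}$ and write $\boldsymbol{\phi}_t := \boldsymbol{\phi}(\boldsymbol{x}_t,\boldsymbol{\theta})\in\mathbb{R}^{N_\phi}$. Consider the Bayesian last layer regression model $y_t = \boldsymbol{w}^\top\boldsymbol{\phi}_t+\varepsilon_t$, with Gaussian prior $p(\boldsymbol{w})=\mathcal{N}(\underline{\bar{\boldsymbol{w}}},\underline{S})$ on $\boldsymbol{w}\in\mathbb{R}^{N_\phi}$ and i.i.d. noise $\varepsilon_t\sim\mathcal{N}(0,\Sigma)$, $\Sigma>0$, independent of $\boldsymbol{w}$. Let $q(\boldsymbol{w}\mid\boldsymbol{\eta})=\mathcal{N}(\bar{\boldsymbol{w}},S)$, $\boldsymbol{\eta}=(\bar{\boldsymbol{w}},S)$, be a Gaussian variational posterior. Then $$\frac1T\log p(Y\mid X,\boldsymbol{\theta})\;\ge\;\mathcal{L}(\boldsymbol{\theta},\boldsymbol{\eta},\Sigma)-\frac1T\,\mathrm{KL}\big(q(\boldsymbol{w}\mid\boldsymbol{\eta})\,\|\,p(\boldsymbol{w})\big),$$ where $$\mathcal{L}(\boldsymbol{\theta},\boldsymbol{\eta},\Sigma)=\frac1T\sum_{t=1}^T\Big(\log\mathcal{N}(y_t\mid\bar{\boldsymbol{w}}^\top\boldsymbol{\phi}_t,\Sigma)-\tfrac12\,\boldsymbol{\phi}_t^\top S\,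\boldsymbol{\phi}_t\,\Sigma^{-1}\Big).$$
   Context: $\boldsymbol{\phi}:\mathbb{R}^{N_x}\times\Theta\to\mathbb{R}^{N_\phi}$ is an arbitrary fixed feature map (a neural network without its last layer, with weights $\boldsymbol{\theta}\in\Theta$). $X=(\boldsymbol{x}_1,\dots,\boldsymbol{x}_T)$ and $Y=(y_1,\dots,y_T)$ denote the stacked data. $\mathcal{N}(\cdot\mid m,C)$ denotes the Gaussian density with mean $m$ and (co)variance $C$; the matrices $S,\underline{S}\in\mathbb{R}^{N_\phi\times N_\phi}$ are symmetric positive definite covariance matrices. The marginal likelihood is $p(Y\mid X,\boldsymbol{\theta})=\mathbb{E}_{\boldsymbol{w}\sim p(\boldsymbol{w})}\big[\prod_{t=1}^T\mathcal{N}(y_t\mid\boldsymbol{w}^\top\boldsymbol{\phi}_t,\Sigma)\big]$. $\mathrm{KL}$ denotes Kullback--Leibler divergence. *)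

(* Defs.v *)
From HB Require Import structures.
From mathcomp Require Import all_boot all_order all_algebra.
From mathcomp Require Import all_classical all_reals all_analysis.

Set Implicit Arguments.
Unset Strict Implicit.
Unset Printing Implicit Defensive.

Import Order.TTheory GRing.Theory Num.Theory.
Import numFieldNormedType.Exports.

Local Open Scope classical_set_scope.
Local Open Scope ring_scope.

(* MathComp-Analysis has product measures and a product sigma-algebra on
   n.-tuple, but no n-dimensional Lebesgue measure: it is built here on
   n.-tuple R, one coordinate at a time, as the image of the product measure
   under (x, s) |-> x :: s. *)
Section lebesgue_cons.
Context (R : realType) (n : nat).
Variable mu : {sigma_finite_measure set (n.-tuple (measurableTypeR R)) -> \bar R}.

Let lebR : {sigma_finite_measure set (measurableTypeR R) -> \bar R} :=
  @lebesgue_measure R.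

Definition tuple_cons (p : measurableTypeR R * n.-tuple (measurableTypeR R)) :
  n.+1.-tuple (measurableTypeR R) := [tuple of p.1 :: p.2].

Lemma measurable_tuple_cons : measurable_fun setT tuple_cons.
Proof. exact: (measurable_cons measurable_fst measurable_snd). Qed.

Definition lebesgue_cons : set (n.+1.-tuple (measurableTypeR R)) -> \bar R :=
  pushforward (lebR \x mu)%E tuple_cons.

Let lebesgue_cons0 : lebesgue_cons set0 = 0%E.
Proof. by rewrite [LHS]measure0 //; exact: measurable_tuple_cons. Qed.

Let lebesgue_cons_ge0 A : (0 <= lebesgue_cons A)%E.
Proof. by apply: measure_ge0; exact: measurable_tuple_cons. Qed.

Let lebesgue_cons_sigma_additive : semi_sigma_additive lebesgue_cons.
Proof.
by apply: measure_semi_sigma_additive; exact: measurable_tuple_cons.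
Qed.

HB.instance Definition _ := isMeasure.Build _ _ _ lebesgue_cons
  lebesgue_cons0 lebesgue_cons_ge0 lebesgue_cons_sigma_additive.

Let lebesgue_cons_sigma_finite : sigma_finite setT lebesgue_cons.
Proof.
have /sigma_finiteP[F [TF ndF Foo]] := sigma_finiteT lebR.
have /sigma_finiteP[G [TG ndG Goo]] := sigma_finiteT mu.
pose u (s : n.+1.-tuple (measurableTypeR R)) :
    measurableTypeR R * n.-tuple (measurableTypeR R) :=
  (thead s, [tuple of behead s]).
have mu_ : measurable_fun setT u.
  by apply: measurable_fun_pair; [exact: measurable_tnth|
                                  exact: measurable_behead].
have uK p : u (tuple_cons p) = p by case: p => a s; congr pair; apply: val_inj.
exists (fun k => u @^-1` (F k `*` G k)).
  rewrite -preimage_bigcup; apply/esym; rewrite predeqE => s; split => // _.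
  have [k _ Fk] : (\bigcup_k F k) (u s).1 by rewrite -TF.
  have [l _ Gl] : (\bigcup_k G k) (u s).2 by rewrite -TG.
  exists (maxn k l) => //; split => /=.
  - by move: Fk; exact/subsetPset/ndF/leq_maxl.
  - by move: Gl; exact/subsetPset/ndG/leq_maxr.
move=> k; have [mF Fk] := Foo k; have [mG Gk] := Goo k; split.
  by rewrite -[X in measurable X]setTI; apply: mu_ => //; exact: measurableX.
rewrite /lebesgue_cons /pushforward.
suff -> : tuple_cons @^-1` (u @^-1` (F k `*` G k)) = F k `*` G k.
  by rewrite product_measure1E// lte_mul_pinfty// ge0_fin_numE.
by rewrite -comp_preimage (_ : u \o tuple_cons = id) ?preimage_id//; apply/funext.
Qed.

HB.instance Definition _ := Measure_isSigmaFinite.Build _ _ _ lebesgue_cons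
  lebesgue_cons_sigma_finite.

End lebesgue_cons.

Fixpoint lebesgue_tuple (R : realType) (n : nat) :
    {sigma_finite_measure set (n.-tuple (measurableTypeR R)) -> \bar R} :=
  match n with
  | 0 => \d_([tuple] : 0.-tuple (measurableTypeR R))
  | n'.+1 => lebesgue_cons (lebesgue_tuple R n')
  end.

(* R^n as column vectors, matching the matrix expressions below. *)
Definition col_tuple (R : realType) (n : nat) (s : n.-tuple (measurableTypeR R)) :
  'cV[R]_n := \col_(i < n) tnth s i.

Definition sym_posdef (R : realType) (n : nat) (S : 'M[R]_n) : Prop :=
  S^T = S /\ forall v : 'cV[R]_n, v != 0 -> 0 < (v^T *m S *m v) 0 0.

(* The library's normal_pdf takes the standard deviation; the second parameter
   here is the variance. *)
Definition gauss_pdf (R : realType) (m v y : R) : R :=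
  normal_pdf m (Num.sqrt v) y.

Definition mvgauss_pdf (R : realType) (n : nat) (m : 'cV[R]_n) (C : 'M[R]_n)
    (w : 'cV[R]_n) : R :=
  (Num.sqrt ((2 * pi) ^+ n * \det C))^-1 *
  expR (- (2^-1) * ((w - m)^T *m invmx C *m (w - m)) 0 0).

(* Expectation of f w for a random vector w on R^n with density p. *)
Definition expectation_pdf (R : realType) (n : nat) (p f : 'cV[R]_n -> R) :
    \bar R :=
  (\int[lebesgue_tuple R n]_s (f (col_tuple s) * p (col_tuple s))%:E)%E.

(* KL(q || p) for densities on R^n, with the usual conventions
   0 log (0 / b) = 0 and a log (a / 0) = +oo for a > 0 (needed because the
   library sets x / 0 = 0 and ln 0 = 0). *)
Definition kl_pdf (R : realType) (n : nat) (q p : 'cV[R]_n -> R) : \bar R :=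
  (\int[lebesgue_tuple R n]_s
    let a := q (col_tuple s) in let b := p (col_tuple s) in
    if a == 0%R then 0%:E
    else if b == 0%R then +oo
    else (a * ln (a / b))%:E)%E.

(* p(Y | X, theta) in the model y_t = w^T phi_t + eps_t, w ~ prior,
   eps_t ~ N(0, Sigma) i.i.d. and independent of w. *)
Definition marginal_likelihood (R : realType) (Nx Nphi T : nat) (Theta : Type)
    (phi : 'cV[R]_Nx -> Theta -> 'cV[R]_Nphi) (prior : 'cV[R]_Nphi -> R)
    (Sigma : R) (x : 'I_T -> 'cV[R]_Nx) (theta : Theta) (y : 'I_T -> R) :
    \bar R :=
  expectation_pdf prior (fun w =>
    \prod_(t < T) gauss_pdf ((w^T *m phi (x t) theta) 0 0) Sigma (y t)).

Definition vbll_objective (R : realType) (Nx Nphi T : nat) (Theta : Type)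
    (phi : 'cV[R]_Nx -> Theta -> 'cV[R]_Nphi)
    (x : 'I_T -> 'cV[R]_Nx) (y : 'I_T -> R)
    (theta : Theta) (wbar : 'cV[R]_Nphi) (S : 'M[R]_Nphi) (Sigma : R) : R :=
  T%:R^-1 * \sum_(t < T)
    (ln (gauss_pdf ((wbar^T *m phi (x t) theta) 0 0) Sigma (y t))
     - 2^-1 * ((phi (x t) theta)^T *m S *m phi (x t) theta) 0 0 * Sigma^-1).

(* Main.v *)
(** Gibbs' variational principle: for c > 0, the inequality 1 + x <= exp x at
    x = ln (L p / (q c)) gives, pointwise,
    q ln (q / p) >= q ln L + q (1 - ln c) - L p / c.
    Integrating, and choosing c to be the marginal likelihood (or letting c
    tend to 0 should that vanish), yields E_q[ln L] - KL(q || p) <= ln E_p[L].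
    Since ln L is a sum of quadratics in w, E_q[ln L] only requires the second
    moment of linear forms under q.  This comes from the moment generating
    function, i.e. from the fact that the Gaussian density integrates to 1 for
    every mean; that in turn follows by integrating out one coordinate at a
    time, each step replacing the precision matrix by a Schur complement. *)

Require Import Defs.
From mathcomp Require Import all_boot all_order all_algebra.
From mathcomp Require Import all_classical all_reals all_analysis.
From mathcomp Require Import measurable_realfun ring lra.

Import Order.TTheory GRing.Theory Num.Theory.
Import numFieldNormedType.Exports.

Local Open Scope ring_scope.

(** * Quadratic forms, positive definiteness and Schur complements *)

Definition quadf {R : realType} {n : nat} (A : 'M[R]_n) (v : 'cV[R]_n) : R :=
  (v^T *m A *m v) 0 0.

(** The Schur complement of the top left pivot, in the form it takes for symmetric [A], whose upper
    right block is the transpose of the lower left one. *)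
Definition schur {R : realType} {n : nat} (A : 'M[R]_(1 + n)) : 'M[R]_n :=
  drsubmx A - (A 0 0)^-1 *: (dlsubmx A *m (dlsubmx A)^T).

Section positive_definite.
Context {R : realType}.

Lemma mx11_tr00 (M : 'M[R]_1) : M^T 0 0 = M 0 0.
Proof. by rewrite mxE. Qed.

Lemma quadf_cons n (A : 'M[R]_(1 + n)) (x : R) (v : 'cV[R]_n) : A^T = A ->
  quadf A (col_mx x%:M v) =
  A 0 0 * x ^+ 2 + 2 * x * (v^T *m dlsubmx A) 0 0 + quadf (drsubmx A) v.
Proof.
move=> sA; have sb : ursubmx A = (dlsubmx A)^T by rewrite trmx_dlsub sA.
rewrite /quadf -[X in _ *m X *m _](submxK A) tr_col_mx mul_row_block mul_row_col.
rewrite sb tr_scalar_mx mul_scalar_mx mul_mx_scalar mul_scalar_mx mulmxDl.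
rewrite -scalemxAl [(dlsubmx A)^T *m v](_ : _ = (v^T *m dlsubmx A)^T); last first.
  by rewrite trmx_mul trmxK.
have ulE : ulsubmx A 0 0 = A 0 0.
  by rewrite !mxE; congr (A _ _); apply: val_inj.
set p := v^T *m dlsubmx A; set q := v^T *m _ *m v.
have E (a c d e : 'M[R]_1) : (x *: (x *: a + c) + (x *: d + e)) 0 0 =
  x * (x * a 0 0 + c 0 0) + (x * d 0 0 + e 0 0) by rewrite !mxE.
by rewrite E mx11_tr00 ulE; ring.
Qed.

(** Completing the square in the first coordinate leaves the Schur complement as the form in the
    remaining coordinates. *)
Lemma quadf_schur n (A : 'M[R]_(1 + n)) (x : R) (v : 'cV[R]_n) : A^T = A ->
  A 0 0 != 0 -> quadf A (col_mx x%:M v) =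
  A 0 0 * (x + (v^T *m dlsubmx A) 0 0 / A 0 0) ^+ 2 + quadf (schur A) v.
Proof.
move=> sA a0; rewrite quadf_cons// /schur {2}/quadf mulmxBr mulmxBl.
rewrite -scalemxAr -scalemxAl.
have -> : v^T *m (dlsubmx A *m (dlsubmx A)^T) *m v =
  (v^T *m dlsubmx A) *m (v^T *m dlsubmx A)^T.
  by rewrite trmx_mul trmxK !mulmxA.
set p := v^T *m dlsubmx A; rewrite /quadf.
set q := v^T *m _ *m v.
have E (M N : 'M[R]_1) c : (M - c *: (N *m N^T)) 0 0 =
    M 0 0 - c * (N 0 0 * N 0 0).
  by rewrite !mxE big_ord1 !mxE.
by rewrite E; field.
Qed.

Lemma posdef00_gt0 n (A : 'M[R]_(1 + n)) : sym_posdef A -> 0 < A 0 0.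
Proof.
(* The first basis vector picks out the corner entry. *)
move=> [sA pA]; have := pA (col_mx 1%:M 0); rewrite -/(quadf _ _) quadf_cons//.
rewrite /quadf trmx0 !mul0mx !mxE expr1n mulr1 mulr0 !addr0; apply.
apply/eqP => /colP/(_ (lshift n 0)); rewrite col_mxEu !mxE /=.
by apply/eqP; rewrite oner_eq0.
Qed.

Lemma posdef_schur n (A : 'M[R]_(1 + n)) : sym_posdef A -> sym_posdef (schur A).
Proof.
move=> hA; have a0 := posdef00_gt0 _ _ hA; have [sA pA] := hA; split.
  by rewrite /schur linearB/= linearZ/= trmx_mul trmxK trmx_drsub sA.
move=> v v0; rewrite -/(quadf _ _).
(* This first coordinate annihilates the completed square, so that only the Schur complement
   remains. *)
have := pA (col_mx (- ((v^T *m dlsubmx A) 0 0 / A 0 0))%:M v).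
rewrite -/(quadf _ _) quadf_schur ?gt_eqF// addNr expr0n mulr0 add0r; apply.
apply: contra v0 => /eqP/colP vE; apply/eqP/colP => i.
by have := vE (rshift 1 i); rewrite col_mxEd !mxE.
Qed.

Lemma det_schur n (A : 'M[R]_(1 + n)) : A^T = A -> A 0 0 != 0 ->
  \det A = A 0 0 * \det (schur A).
Proof.
move=> sA a0.
have Aul : ulsubmx A = (A 0 0)%:M.
  by rewrite [LHS]mx11_scalar !mxE; congr (A _ _)%:M; apply: val_inj.
have sb : ursubmx A = (dlsubmx A)^T by rewrite trmx_dlsub sA.
rewrite -{1}(submxK A) Aul.
(* One step of block elimination: a unit lower triangular factor times an upper triangular one with
   diagonal blocks [A 0 0] and [schur A]. *)
have -> : block_mx (A 0 0)%:M (ursubmx A) (dlsubmx A) (drsubmx A) =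
  block_mx 1%:M 0 ((A 0 0)^-1 *: dlsubmx A) 1%:M *m
  block_mx (A 0 0)%:M (ursubmx A) 0 (schur A).
  rewrite mulmx_block !mul0mx !mul1mx !addr0 mul_mx_scalar scalerA.
  by rewrite divff// scale1r /schur sb -scalemxAl addrC subrK.
by rewrite det_mulmx det_lblock det_ublock !det1 !mul1r det_scalar expr1.
Qed.

Lemma posdef_det_gt0 n (A : 'M[R]_n) : sym_posdef A -> 0 < \det A.
Proof.
elim: n A => [|n IH] A hA; first by rewrite det_mx00.
have a0 := posdef00_gt0 _ _ hA.
by rewrite det_schur ?gt_eqF ?mulr_gt0 ?IH//; [exact: posdef_schur|case: hA].
Qed.

Lemma posdef_unitmx n (A : 'M[R]_n) : sym_posdef A -> A \in unitmx.
Proof. by move=> /posdef_det_gt0 d0; rewrite unitmxE unitfE gt_eqF. Qed.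

Lemma posdef_inv n (A : 'M[R]_n) : sym_posdef A -> sym_posdef (invmx A).
Proof.
move=> hA; have uA := posdef_unitmx _ _ hA; have [sA pA] := hA; split.
  by rewrite trmx_inv sA.
(* With [u = invmx A *m v], the form of [invmx A] at [v] is the form of [A] at [u]. *)
move=> v v0; have := pA (invmx A *m v).
rewrite trmx_mul trmx_inv sA -[_ *m A *m _]mulmxA mulKVmx//; apply.
apply: contra v0 => /eqP /(congr1 (mulmx A)); rewrite mulKVmx// => ->.
by rewrite mulmx0.
Qed.

(* Completing the square: a linear tilt of a Gaussian only shifts its mean. *)
Lemma quadf_subZ n (S : 'M[R]_n) (v f : 'cV[R]_n) (t : R) : sym_posdef S ->
  quadf (invmx S) (v - t *: (S *m f)) =
  quadf (invmx S) v - 2 * t * (v^T *m f) 0 0 + t ^+ 2 * quadf S f.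
Proof.
move=> hS; have uS := posdef_unitmx _ _ hS; have [sS _] := hS.
have vE : (v - t *: (S *m f))^T = v^T - t *: (f^T *m S).
  by apply/rowP => i; rewrite -[in RHS]sS -trmx_mul !mxE.
rewrite /quadf vE !mulmxBl !mulmxBr -!scalemxAl.
rewrite -!scalemxAr mulmxK// -[v^T *m invmx S *m (S *m f)]mulmxA mulKmx//.
have fvE : (f^T *m v) 0 0 = (v^T *m f) 0 0.
  by rewrite -[RHS]mx11_tr00 trmx_mul trmxK.
rewrite [f^T *m (S *m f)]mulmxA.
set p := v^T *m _ *m v; set q := v^T *m f; set r := f^T *m v.
have E (a b c d : 'M[R]_1) : (a - t *: b - (t *: c - t *: (t *: d))) 0 0 =
   a 0 0 - t * b 0 0 - (t * c 0 0 - t * (t * d 0 0)) by rewrite !mxE.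
by rewrite E fvE -/q; ring.
Qed.

End positive_definite.

(** * Gaussian integrals in any dimension *)

Section gaussian_integral.
Context {R : realType}.
Local Open Scope classical_set_scope.

Lemma measurable_affine_tuple n (m f : 'cV[R]_n) :
  measurable_fun [set: n.-tuple (measurableTypeR R)]
    (fun s => ((col_tuple s - m)^T *m f) 0 0 : measurableTypeR R).
Proof.
under eq_fun do rewrite mxE; apply: measurable_sum => i.
apply: measurable_funM => //.
under eq_fun do rewrite !mxE.
by apply: measurable_funB => //; exact: measurable_tnth.
Qed.

Lemma measurable_quadf_tuple n (A : 'M[R]_n) (m : 'cV[R]_n) :
  measurable_fun [set: n.-tuple (measurableTypeR R)]
    (fun s => quadf A (col_tuple s - m) : measurableTypeR R).
Proof.
rewrite /quadf; under eq_fun do rewrite -mulmxA mxE.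
apply: measurable_sum => i; under eq_fun do rewrite !mxE.
apply: measurable_funM; last apply: measurable_sum => j.
  by apply: measurable_funB => //; exact: measurable_tnth.
under eq_fun do rewrite !mxE.
apply: measurable_funM => //.
by apply: measurable_funB => //; exact: measurable_tnth.
Qed.

(** The integrand is a multiple of the normal density with mean [- c] and variance [a^-1], whose
    mass is 1. *)
Lemma integral_gauss1 (a c : R) : 0 < a ->
  (\int[@lebesgue_measure R]_x (expR (- 2^-1 * (a * (x + c) ^+ 2)))%:E =
   (Num.sqrt (2 * pi / a))%:E)%E.
Proof.
move=> a0; have s0 : 0 < Num.sqrt a^-1 by rewrite sqrtr_gt0 invr_gt0.
have s2 : Num.sqrt a^-1 ^+ 2 = a^-1 by rewrite sqr_sqrtr// invr_ge0 ltW.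
have p0 : 0 < Num.sqrt (2 * pi / a).
  by rewrite sqrtr_gt0 divr_gt0// mulr_gt0// pi_gt0.
have E x : expR (- 2^-1 * (a * (x + c) ^+ 2)) =
    Num.sqrt (2 * pi / a) * normal_pdf (- c) (Num.sqrt a^-1) x.
  rewrite normal_pdfE ?gt_eqF//= /normal_peak /normal_fun s2 opprK.
  have -> : a^-1 * pi *+ 2 = 2 * pi / a by rewrite mulr2n; ring.
  rewrite mulVKf ?gt_eqF//; congr expR.
  by field; rewrite gt_eqF.
under eq_integral do rewrite E EFinM.
rewrite ge0_integralZl//.
- by rewrite integral_normal_pdf mule1.
- by apply/measurable_EFinP; exact: measurable_normal_pdf.
- by move=> x _; rewrite lee_fin normal_pdf_ge0.
Qed.

(** Here [A] is a precision matrix. By induction on the dimension: integrating out the first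
    coordinate gives the factor [Num.sqrt (2 * pi / A 0 0)] and leaves a Gaussian with precision
    [schur A]; [det_schur] then matches the determinants. *)
Lemma integral_gauss n (A : 'M[R]_n) (m : 'cV[R]_n) : sym_posdef A ->
  (\int[lebesgue_tuple R n]_s
      (expR (- 2^-1 * quadf A (col_tuple s - m)))%:E =
   (Num.sqrt ((2 * pi) ^+ n / \det A))%:E)%E.
Proof.
elim: n A m => [|n IH] A m hA.
  (* In dimension 0 the measure is the unit mass at the empty tuple, and both sides equal 1. *)
  rewrite integral_dirac//; last first.
    apply/measurable_EFinP/measurableT_comp; first exact: measurable_expR.
    by apply: measurable_funM => //; exact: measurable_quadf_tuple.
  by rewrite diracT mul1e /quadf thinmx0 mul0mx mxE mulr0 expR0 det_mx00
    expr0 divr1 sqrtr1.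
have a0 := posdef00_gt0 _ _ hA; have [sA _] := hA.
have mq k (B : 'M[R]_k) v : measurable_fun setT
    (fun s : k.-tuple (measurableTypeR R) =>
      (expR (- 2^-1 * quadf B (col_tuple s - v)))%:E).
  apply/measurable_EFinP/measurableT_comp; first exact: measurable_expR.
  by apply: measurable_funM => //; exact: measurable_quadf_tuple.
rewrite [lebesgue_tuple R n.+1]/=.
rewrite (ge0_integral_pushforward (@measurable_tuple_cons R n))//; last first.
  exact: mq.
(* Tonelli's theorem puts the first coordinate in the inner integral, with the tail fixed. *)
rewrite preimage_setT fubini_tonelli2; last 2 first.
- by apply: (measurableT_comp (mq _ A m)); exact: measurable_tuple_cons.
- by move=> z /=; rewrite lee_fin expR_ge0.
rewrite /fubini_G.
pose b := dlsubmx (A : 'M[R]_(1 + n)).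
pose m0 := m 0 0; pose mt := dsubmx (m : 'cV[R]_(1 + n)).
(* For a fixed tail [s], the second factor is a one-dimensional Gaussian in [x]; its centre depends
   on [s], but its integral does not. *)
have E (x : measurableTypeR R) (s : n.-tuple (measurableTypeR R)) :
    ((expR (- 2^-1 * quadf A (col_tuple (tuple_cons (x, s)) - m)))%:E =
    (expR (- 2^-1 * quadf (schur A) (col_tuple s - mt)))%:E *
    (expR (- 2^-1 * (A 0 0 * (x + (((col_tuple s - mt)^T *m b) 0 0 / A 0 0
       - m0)) ^+ 2)))%:E)%E.
  rewrite -EFinM -expRD; congr (expR _)%:E.
  rewrite [_ - m](_ : _ = col_mx (x - m0)%:M (col_tuple s - mt)); last first.
    apply/colP => i; rewrite -[i]/(i : 'I_(1 + n)).
    case: (split_ordP (i : 'I_(1 + n))) => j ->.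
      rewrite col_mxEu !mxE (ord1 j) (tnth_nth 0) /= /m0.
      by rewrite (_ : lshift n 0 = 0)//; exact: val_inj.
    by rewrite col_mxEd !mxE !(tnth_nth 0).
  rewrite quadf_schur ?gt_eqF// -/b; ring.
transitivity (\int[lebesgue_tuple R n]_s ((Num.sqrt (2 * pi / A 0 0))%:E *
    (expR (- 2^-1 * quadf (schur A) (col_tuple s - mt)))%:E))%E.
  apply: eq_integral => s _; rewrite /fubini_G.
  rewrite -(integral_gauss1 (A 0 0) (((col_tuple s - mt)^T *m b) 0 0 / A 0 0
    - m0))// muleC -ge0_integralZl//; last first.
    apply/measurable_EFinP/measurableT_comp; first exact: measurable_expR.
    do 2?[apply: measurable_funM => //]; apply: measurable_funX.
    exact: measurable_funD.
  by apply: eq_integral => x _; exact: E.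
rewrite ge0_integralZl//; last exact: mq.
rewrite IH; last exact: posdef_schur.
rewrite -EFinM -sqrtrM; last first.
  by rewrite divr_ge0 ?(ltW a0)// mulr_ge0// pi_ge0.
rewrite det_schur ?gt_eqF// exprS invfM.
by congr (Num.sqrt _)%:E; ring.
Qed.

End gaussian_integral.

(** * Exponential inequalities and a limit *)

Section exponential_bounds.
Context {R : realType}.

(** The difference of the two sides vanishes at 0, and its derivative equals
    [(expR x - 1) ^+ 2 / expR x], which is nonnegative. *)
Lemma expR_sinh_ge (u : R) : 0 <= u -> 2 * u <= expR u - expR (- u).
Proof.
move=> u0.
have dp (x : R) : is_derive x 1 (fun y : R => expR y - expR (- y) - 2 * y)
    (expR x + expR (- x) - 2).
  have d1 : is_derive x 1 (fun y : R => expR (- y)) (- expR (- x)).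
    by rewrite -mulrN1; apply: (@is_derive1_comp _ expR (fun y => - y)).
  apply: is_derive_eq.
  by rewrite /GRing.scale/= opprK mulr1.
have := @ger0_derive1_le_cc R (fun y => expR y - expR (- y) - 2 * y) 0 u.
have ct : continuous (fun y : R => expR y - expR (- y) - 2 * y).
  by move=> x; apply/differentiable_continuous/derivable1_diffP; case: (dp x).
move=> /(_ _ _ _ 0 u); rewrite oppr0 subrr mulr0 subr0 subr_ge0; apply.
- by move=> x _; case: (dp x).
- move=> x _; rewrite derive1E; case: (dp x) => _ ->.
  have e0 := expR_gt0 x; rewrite expRN.
  have -> : expR x + (expR x)^-1 - 2 = (expR x - 1) ^+ 2 / expR x.
    by field; rewrite gt_eqF.
  by rewrite divr_ge0 ?sqr_ge0 ?ltW.
- exact: continuous_subspaceT.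
- by rewrite in_itv /= lexx.
- by rewrite in_itv /= u0 lexx.
- exact: u0.
Qed.

(** For [0 <= y], [expR y + expR (- y) - 2] is the square of [expR (y / 2) - expR (- (y / 2))],
    which is at least [y] by [expR_sinh_ge]. Negative arguments follow by evenness. *)
Lemma expR_cosh_ge (x : R) : x ^+ 2 + 2 <= expR x + expR (- x).
Proof.
have H (y : R) : 0 <= y -> y ^+ 2 + 2 <= expR y + expR (- y).
  move=> y0; have := @expR_sinh_ge (y / 2) ltac:(lra).
  have -> : 2 * (y / 2) = y by field.
  have e : expR (y / 2) * expR (- (y / 2)) = 1 by rewrite -expRD subrr expR0.
  have -> : expR y = expR (y / 2) ^+ 2.
    by rewrite expr2 -expRD; congr expR; field.
  have -> : expR (- y) = expR (- (y / 2)) ^+ 2.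
    by rewrite expr2 -expRD; congr expR; field.
  move=> le; have : y ^+ 2 <= (expR (y / 2) - expR (- (y / 2))) ^+ 2.
    by rewrite ler_pXn2r// nnegrE// (le_trans y0).
  by rewrite sqrrB e; lra.
have [/H //|/ltW x0] := leP 0 x.
by rewrite -sqrrN addrC [expR x + _]addrC -{3}(opprK x) [2 + _]addrC H// oppr_ge0.
Qed.

(** This is [1 - x <= expR (- x)] multiplied by [expR x]. *)
Lemma expR_sub1_le (x : R) : expR x - 1 <= x * expR x.
Proof.
have := expR_ge1Dx (- x); rewrite expRN => h.
have e0 := expR_gt0 x.
have : (1 - x) * expR x <= 1.
  by rewrite -ler_pdivlMr// div1r.
lra.
Qed.

(* Bounding the square by exponentials reduces the second moment to the
   moment generating function; the bound is sharp as [t] tends to [0]. *)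
Lemma sqr_le_expR (d z t : R) : 0 < t ->
  (d - z) ^+ 2 + (t^-1 + 2 * t^-2) <=
  d ^+ 2 + t^-1 * expR (- 2 * d * t * z) +
  (t^-2 * expR (t * z) + t^-2 * expR (- t * z)).
Proof.
move=> t0; have h1 := expR_ge1Dx (- 2 * d * t * z).
have h2 := expR_cosh_ge (t * z); rewrite [- t * z]mulNr.
have {}h1 : t^-1 * (1 + - 2 * d * t * z) <= t^-1 * expR (- 2 * d * t * z).
  by rewrite ler_pM2l ?invr_gt0.
have {}h2 : t^-2 * ((t * z) ^+ 2 + 2) <= t^-2 * (expR (t * z) + expR (- (t * z))).
  by rewrite ler_pM2l// invr_gt0 exprn_gt0.
have e1 : t^-1 * (1 + - 2 * d * t * z) = t^-1 - 2 * d * z.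
  by field; rewrite gt_eqF.
have e2 : t^-2 * ((t * z) ^+ 2 + 2) = z ^+ 2 + 2 * t^-2.
  by field; rewrite gt_eqF.
rewrite e1 in h1; rewrite e2 mulrDr in h2.
have -> : (d - z) ^+ 2 = d ^+ 2 - 2 * d * z + z ^+ 2 by ring.
lra.
Qed.

(** The right-hand side is continuous in [t] with value [c + b] at 0, so the bound survives as [t]
    decreases to 0. *)
Lemma le_expR_limit (I a b c : R) :
  (forall t, 0 < t -> I <= c + t * a * expR (t ^+ 2 * a) + b * expR (t ^+ 2 * (b / 2))) ->
  I <= c + b.
Proof.
move=> H.
have ct : continuous (fun t : R =>
    c + t * a * expR (t ^+ 2 * a) + b * expR (t ^+ 2 * (b / 2))).
  move=> t; apply: cvgD; first apply: cvgD; first exact: cvg_cst.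
    apply: cvgM; first by apply: cvgM; [exact: cvg_id|exact: cvg_cst].
    apply: continuous_comp; last exact: continuous_expR.
    by apply: cvgM; [exact: exprn_continuous|exact: cvg_cst].
  apply: cvgM; first exact: cvg_cst.
  apply: continuous_comp; last exact: continuous_expR.
  by apply: cvgM; [exact: exprn_continuous|exact: cvg_cst].
have := ct 0; rewrite /continuous_at expr0n !mul0r expR0 mulr1 addr0 => /cvg_at_right_filter.
move=> /cvgr_to_ge; apply.
near=> t; apply: H; near: t; exact: nbhs_right_gt.
Unshelve. all: by end_near. Qed.

End exponential_bounds.

(** * Positivity, measurability and total mass of the Gaussian density *)

Section gaussian_moments.
Context {R : realType} {n : nat}.
Variables (m : 'cV[R]_n) (S : 'M[R]_n).
Hypothesis hS : sym_posdef S.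
Local Open Scope classical_set_scope.

Lemma mvgauss_pdfE w : mvgauss_pdf m S w =
  (Num.sqrt ((2 * pi) ^+ n * \det S))^-1 * expR (- 2^-1 * quadf (invmx S) (w - m)).
Proof. by []. Qed.

Lemma mvgauss_pdf_gt0 w : 0 < mvgauss_pdf m S w.
Proof.
rewrite mulr_gt0 ?expR_gt0// invr_gt0 sqrtr_gt0.
by rewrite mulr_gt0 ?posdef_det_gt0// exprn_gt0// mulr_gt0// pi_gt0.
Qed.

Lemma measurable_mvgauss_pdf :
  measurable_fun [set: n.-tuple (measurableTypeR R)]
    (fun s => mvgauss_pdf m S (col_tuple s) : measurableTypeR R).
Proof.
apply: measurable_funM => //; apply: measurableT_comp; first exact: measurable_expR.
by apply: measurable_funM => //; exact: measurable_quadf_tuple.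
Qed.

Lemma integral_mvgauss_pdf :
  (\int[lebesgue_tuple R n]_s (mvgauss_pdf m S (col_tuple s))%:E = 1)%E.
Proof.
have hV := posdef_inv _ _ hS.
under eq_integral do rewrite mvgauss_pdfE EFinM.
rewrite ge0_integralZl//; last first.
- apply/measurable_EFinP/measurableT_comp; first exact: measurable_expR.
  by apply: measurable_funM => //; exact: measurable_quadf_tuple.
(* The normalising factor is written with the covariance [S], while the integral involves the
   precision [invmx S]; [det_inv] reconciles the two. *)
rewrite integral_gauss// det_inv invrK -EFinM mulVf// gt_eqF// sqrtr_gt0.
by rewrite mulr_gt0 ?posdef_det_gt0// exprn_gt0// mulr_gt0// pi_gt0.
Qed.

End gaussian_moments.

(** * Moment generating function and second moment of linear forms *)

Section gaussian_second_moment.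
Context {R : realType} {n : nat}.
Variables (m : 'cV[R]_n) (S : 'M[R]_n).
Hypothesis hS : sym_posdef S.
Local Open Scope classical_set_scope.

Lemma mvgauss_pdf_tilt (f w : 'cV[R]_n) (t : R) :
  mvgauss_pdf m S w * expR (t * ((w - m)^T *m f) 0 0) =
  expR (t ^+ 2 * (quadf S f / 2)) * mvgauss_pdf (m + t *: (S *m f)) S w.
Proof.
rewrite !mvgauss_pdfE opprD addrA quadf_subZ// [RHS]mulrCA -[LHS]mulrA -!expRD.
by congr (_ * expR _); field.
Qed.

(** The tilted density is a constant times a Gaussian density with shifted mean; the latter has mass
    1, so only the constant survives. *)
Lemma mvgauss_mgf (f : 'cV[R]_n) (t : R) :
  (\int[lebesgue_tuple R n]_s (mvgauss_pdf m S (col_tuple s) *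
     expR (t * ((col_tuple s - m)^T *m f) 0 0))%:E =
   (expR (t ^+ 2 * (quadf S f / 2)))%:E)%E.
Proof.
under eq_integral do rewrite mvgauss_pdf_tilt EFinM.
rewrite ge0_integralZl//.
- by rewrite integral_mvgauss_pdf// mule1.
- by apply/measurable_EFinP; exact: measurable_mvgauss_pdf.
- by move=> s _; rewrite lee_fin ltW// mvgauss_pdf_gt0.
Qed.

(** An upper bound suffices, since squared residuals enter the log-likelihood with a negative
    coefficient. The inequality [sqr_le_expR] is integrated against the density, [mvgauss_mgf]
    evaluates the exponentials, and [t] tends to 0. *)
Lemma mvgauss_second_moment (f : 'cV[R]_n) (d : R) :
  (\int[lebesgue_tuple R n]_s (mvgauss_pdf m S (col_tuple s) *
     (d - ((col_tuple s - m)^T *m f) 0 0) ^+ 2)%:E <=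
   (d ^+ 2 + quadf S f)%:E)%E.
Proof.
set q := fun s => mvgauss_pdf m S (col_tuple s).
set z := fun s : n.-tuple (measurableTypeR R) => ((col_tuple s - m)^T *m f) 0 0.
have q0 s : 0 <= q s by rewrite ltW// mvgauss_pdf_gt0.
have mq : measurable_fun setT q := measurable_mvgauss_pdf _ _.
have mz : measurable_fun setT z := measurable_affine_tuple _ _ _.
pose I := (\int[lebesgue_tuple R n]_s (q s * (d - z s) ^+ 2)%:E)%E.
rewrite -[X in (X <= _)%E]/I.
have mdz : measurable_fun setT (fun s => q s * (d - z s) ^+ 2).
  by apply: measurable_funM => //; apply: measurable_funX; exact: measurable_funB.
have mqe t : measurable_fun setT (fun s => q s * expR (t * z s)).
  apply: measurable_funM => //; apply: measurableT_comp.
    exact: measurable_expR.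
  exact: measurable_funM.
pose N (g : n.-tuple (measurableTypeR R) -> R) :=
  (forall s, 0 <= g s) /\ measurable_fun setT g.
have Nq : N q by [].
have Ne t : N (fun s => q s * expR (t * z s)).
  by split=> // s; rewrite mulr_ge0// expR_ge0.
have Nd : N (fun s => q s * (d - z s) ^+ 2).
  by split=> // s; rewrite mulr_ge0// sqr_ge0.
have NM c g : 0 <= c -> N g -> N (fun s => c * g s).
  by move=> c0 [g0 mg]; split=> [s|]; [rewrite mulr_ge0|exact: measurable_funM].
have ND g h : N g -> N h -> N (fun s => g s + h s).
  move=> [g0 mg] [h0 mh].
  by split=> [s|]; [rewrite addr_ge0|exact: measurable_funD].
have IM c g : 0 <= c -> N g -> (\int[lebesgue_tuple R n]_s (c * g s)%:E =
    c%:E * \int[lebesgue_tuple R n]_s (g s)%:E)%E.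
  move=> c0 [g0 mg]; under eq_integral do rewrite EFinM.
  rewrite ge0_integralZl//; first exact/measurable_EFinP.
  by move=> s _; rewrite lee_fin.
have ID g h : N g -> N h -> (\int[lebesgue_tuple R n]_s (g s + h s)%:E =
    \int[lebesgue_tuple R n]_s (g s)%:E + \int[lebesgue_tuple R n]_s (h s)%:E)%E.
  move=> [g0 mg] [h0 mh]; under eq_integral do rewrite EFinD.
  by rewrite ge0_integralD//; try exact/measurable_EFinP;
    move=> s _; rewrite lee_fin.
have Ile g h : N g -> N h -> (forall s, g s <= h s) ->
    (\int[lebesgue_tuple R n]_s (g s)%:E <= \int[lebesgue_tuple R n]_s (h s)%:E)%E.
  move=> [g0 mg] [h0 mh] gh; apply: ge0_le_integral => //;
    try exact/measurable_EFinP; by move=> s _; rewrite lee_fin.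
(* The constant stays on the left: all integrands are then nonnegative, and nothing is subtracted
   before [I] is known to be finite. *)
have main t : 0 < t -> (I + (t^-1 + 2 * t^-2)%:E <=
    (d ^+ 2 + t^-1 * expR ((- 2 * d * t) ^+ 2 * (quadf S f / 2)) +
    (t^-2 * expR (t ^+ 2 * (quadf S f / 2)) +
     t^-2 * expR (t ^+ 2 * (quadf S f / 2))))%:E)%E.
  move=> t0; pose k := t^-1 + 2 * t^-2.
  have ti0 : 0 <= t^-1 by rewrite invr_ge0 ltW.
  have tii0 : 0 <= t^-2 by rewrite invr_ge0 exprn_ge0// ltW.
  have k0 : 0 <= k by rewrite addr_ge0// mulr_ge0.
  have N1 := NM _ _ (sqr_ge0 d) Nq.
  have N2 := NM _ _ ti0 (Ne (- 2 * d * t)).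
  have N3 := NM _ _ tii0 (Ne t).
  have N4 := NM _ _ tii0 (Ne (- t)).
  have := Ile _ _ (ND _ _ Nd (NM _ _ k0 Nq)) (ND _ _ (ND _ _ N1 N2) (ND _ _ N3 N4)).
  rewrite (ID _ _ Nd (NM _ _ k0 Nq)) (ID _ _ (ND _ _ N1 N2) (ND _ _ N3 N4)).
  rewrite (ID _ _ N1 N2) (ID _ _ N3 N4) (IM _ _ k0 Nq) (IM _ _ (sqr_ge0 d) Nq).
  rewrite (IM _ _ ti0 (Ne (- 2 * d * t))) (IM _ _ tii0 (Ne t)) (IM _ _ tii0 (Ne (- t))).
  (* The moment generating function is even, so the terms for [t] and [- t] coincide. *)
  rewrite integral_mvgauss_pdf// !mule1 !mvgauss_mgf sqrrN -!EFinM -!EFinD.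
  apply=> s; have := ler_wpM2l (q0 s) (sqr_le_expR d (z s) t t0).
  by rewrite /k !mulrDr mulrDl; lra.
have I0 : (0 <= I)%E by apply: integral_ge0 => s _; rewrite lee_fin; case: Nd.
(* The instance [t = 1] of [main] bounds [I] by a real number. *)
have Ifin : I \is a fin_num.
  rewrite ge0_fin_numE//; apply: le_lt_trans (ltry _).
  by apply: le_trans (main 1 ltr01); rewrite leeDl// lee_fin invr1 expr1n.
rewrite -(fineK Ifin) lee_fin.
apply: (le_expR_limit _ (2 * d ^+ 2 * quadf S f)).
move=> t t0; have := main t t0.
rewrite -(fineK Ifin) -EFinD lee_fin.
rewrite (_ : (- 2 * d * t) ^+ 2 * (quadf S f / 2) =
  t ^+ 2 * (2 * d ^+ 2 * quadf S f)); last by field.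
set a := 2 * d ^+ 2 * _; set b := quadf S f.
(* Moved to the right, the constants [t^-1] and [2 * t^-2] turn the exponentials into differences
   [expR _ - 1], of order [t ^+ 2]; this cancels the negative powers of [t]. *)
have ha : t^-1 * (expR (t ^+ 2 * a) - 1) <= t * a * expR (t ^+ 2 * a).
  rewrite -[leRHS](mulKf (lt0r_neq0 t0)) ler_wpM2l ?invr_ge0 ?(ltW t0)//.
  by rewrite !mulrA -expr2; exact: expR_sub1_le.
have hb : t^-2 * (expR (t ^+ 2 * (b / 2)) - 1) <= b / 2 * expR (t ^+ 2 * (b / 2)).
  have t20 : 0 < t ^+ 2 by rewrite exprn_gt0.
  rewrite -[leRHS](mulKf (lt0r_neq0 t20)) ler_wpM2l ?invr_ge0 ?(ltW t20)//.
  by rewrite !mulrA -[t ^+ 2 * b / 2]mulrA; exact: expR_sub1_le.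
rewrite mulrBr mulr1 in ha; rewrite mulrBr mulr1 in hb.
lra.
Qed.

End gaussian_second_moment.

(** * Gibbs' variational inequality for positive densities *)

Section variational_bound.
Context {d : measure_display} {X : measurableType d} {R : realType}.
Variable mu : {measure set X -> \bar R}.
Local Open Scope classical_set_scope.

(** The integral of [g] may be infinite, as can happen for the Kullback--Leibler integrand, so
    positive and negative parts are compared separately. *)
Lemma le_integral_lower (h g : X -> \bar R) : mu.-integrable setT h ->
  measurable_fun setT g -> (forall x, h x <= g x)%E ->
  (\int[mu]_x h x <= \int[mu]_x g x)%E.
Proof.
move=> /integrableP[mh _] mg hg; rewrite integralE [leRHS]integralE.
apply: leeB; apply: ge0_le_integral => //; try exact: measurable_funepos;
  try exact: measurable_funeneg.
- by move=> x _; apply: (@funepos_le _ _ setT); rewrite ?inE// => y _.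
- by move=> x _; apply: (@funeneg_le _ _ setT); rewrite ?inE// => y _.
Qed.

Variables (q p L : X -> R) (A : R).
Hypotheses (q_gt0 : forall x, 0 < q x) (p_gt0 : forall x, 0 < p x).
Hypothesis L_gt0 : forall x, 0 < L x.
Hypotheses (mq : measurable_fun setT q) (mp : measurable_fun setT p).
Hypothesis mL : measurable_fun setT L.
Hypothesis int_q : (\int[mu]_x (q x)%:E = 1)%E.
Hypothesis int_qlnL : mu.-integrable setT (fun x => (q x * ln (L x))%:E).
Hypothesis A_le : (A%:E <= \int[mu]_x (q x * ln (L x))%:E)%E.

Let KL := (\int[mu]_x (q x * ln (q x / p x))%:E)%E.

(** The integrated form of the pointwise bound. The constant [c] stays free because two different
    choices of it are made in [variational_bound]. *)
Lemma kl_ge (c r : R) : 0 < c -> (\int[mu]_x (L x * p x)%:E = r%:E)%E ->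
  ((A - ln c - r / c + 1)%:E <= KL)%E.
Proof.
move=> c0 int_r.
have mLp : measurable_fun setT (fun x => (L x * p x)%:E).
  by apply/measurable_EFinP; exact: measurable_funM.
have int_Lp : mu.-integrable setT (fun x => (L x * p x)%:E).
  apply/integrableP; split => //.
  under eq_integral do rewrite gee0_abs ?lee_fin ?mulr_ge0 ?ltW//.
  by rewrite int_r ltry.
have mEq : measurable_fun setT (fun x => (q x)%:E) by exact/measurable_EFinP.
have int_q' : mu.-integrable setT (fun x => (q x)%:E).
  apply/integrableP; split => //.
  under eq_integral do rewrite gee0_abs ?lee_fin ?ltW//.
  by rewrite int_q ltry.
pose k := (1 - ln c)%R.
have i1 : mu.-integrable setT (fun x => k%:E * (q x)%:E)%E by exact: integrableZl.
have i2 : mu.-integrable setT (fun x => (- c^-1)%:E * (L x * p x)%:E)%E.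
  exact: integrableZl.
have i3 := integrableD measurableT i1 i2.
have i4 := integrableD measurableT int_qlnL i3.
have -> : (A - ln c - r / c + 1)%:E = (A%:E + (k%:E + (- c^-1)%:E * r%:E))%E.
  by rewrite -EFinM -!EFinD /k; congr _%:E; ring.
apply: (@le_trans _ _ (\int[mu]_x ((q x * ln (L x))%:E +
    (k%:E * (q x)%:E + (- c^-1)%:E * (L x * p x)%:E)))%E).
  rewrite integralD// integralD// !integralZl// int_q int_r mule1.
  by rewrite leeD2r.
apply: le_integral_lower => //.
  apply/measurable_EFinP; apply: measurable_funM => //.
  under eq_fun do rewrite ln_div ?posrE//.
  by apply: measurable_funB; apply: measurableT_comp => //; exact: measurable_ln.
move=> x; rewrite -!EFinM -!EFinD lee_fin.
have q0 := q_gt0 x; have p0 := p_gt0 x; have L0 := L_gt0 x.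
have h := expR_ge1Dx (ln (L x * p x / (q x * c))).
rewrite lnK ?posrE ?divr_gt0 ?mulr_gt0// in h.
rewrite ln_div ?posrE ?mulr_gt0// !lnM ?posrE// in h.
rewrite ln_div ?posrE//.
have := ler_wpM2l (ltW q0) h.
have -> : q x * (L x * p x / (q x * c)) = c^-1 * (L x * p x).
  by field; rewrite !gt_eqF.
rewrite /k; lra.
Qed.

Lemma variational_bound : (A%:E - KL <= lne (\int[mu]_x (L x * p x)%:E))%E.
Proof.
case int_r : (\int[mu]_x (L x * p x)%:E)%E => [r| |].
- have r0 : 0 <= r.
    rewrite -lee_fin -int_r; apply: integral_ge0 => x _.
    by rewrite lee_fin mulr_ge0 ?ltW.
  rewrite /lne; case: ifPn => [r0'|]; last rewrite -ltNge => {}r0.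
    have {r0'}r0 : r = 0 by apply/eqP; rewrite eq_le r0 r0'.
    (* Since [lne] is [-oo] at 0, the divergence has to be infinite: with [c = expR (A + 1 - x)] the
       lower bound of [kl_ge] becomes the arbitrary real [x]. *)
    suff -> : KL = +oo%E by [].
    apply/eqyP => x x0.
    have := kl_ge (expR (A + 1 - x)) r (expR_gt0 _) int_r.
    rewrite r0 mul0r subr0 expRK; apply: le_trans.
    by rewrite lee_fin; lra.
  (* The choice [c = r] maximises [- ln c - r / c], and the lower bound becomes [A - ln r]. *)
  have := kl_ge r r r0 int_r; rewrite divff ?gt_eqF// subrK.
  case: KL => [k| |] //; first by rewrite -EFinB !lee_fin; lra.
  by move=> _; rewrite addeNy leNye.
- by rewrite leey.
- have : (0 <= \int[mu]_x (L x * p x)%:E)%E.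
    by apply: integral_ge0 => x _; rewrite lee_fin mulr_ge0 ?ltW.
  by rewrite int_r.
Qed.

End variational_bound.

(** * The scalar Gaussian density of the noise and its logarithm *)

Section gaussian_likelihood.
Context {R : realType}.

Lemma gauss_pdfE (u v y : R) : 0 < v -> gauss_pdf u v y =
  normal_peak (Num.sqrt v) * expR (- ((y - u) ^+ 2 / (2 * v))).
Proof.
move=> v0; rewrite /gauss_pdf normal_pdfE ?gt_eqF ?sqrtr_gt0// /normal_fun.
by rewrite sqr_sqrtr ?(ltW v0)// mulNr mulr_natl.
Qed.

Lemma gauss_peak_gt0 (v : R) : 0 < v -> 0 < normal_peak (Num.sqrt v).
Proof. by move=> v0; rewrite normal_peak_gt0// gt_eqF// sqrtr_gt0. Qed.

Lemma gauss_pdf_gt0 (u v y : R) : 0 < v -> 0 < gauss_pdf u v y.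
Proof. by move=> v0; rewrite gauss_pdfE// mulr_gt0 ?expR_gt0// gauss_peak_gt0. Qed.

Lemma ln_gauss_pdf (u v y : R) : 0 < v -> ln (gauss_pdf u v y) =
  ln (normal_peak (Num.sqrt v)) - (y - u) ^+ 2 / (2 * v).
Proof.
by move=> v0; rewrite gauss_pdfE// lnM ?posrE ?expR_gt0 ?gauss_peak_gt0// expRK.
Qed.

Lemma ln_prod (I : Type) (s : seq I) (F : I -> R) : (forall i, 0 < F i) ->
  ln (\prod_(i <- s) F i) = \sum_(i <- s) ln (F i).
Proof.
move=> F0; elim: s => [|i s IH]; first by rewrite !big_nil ln1.
by rewrite !big_cons lnM ?posrE ?prodr_gt0// IH.
Qed.

End gaussian_likelihood.

(** * Expected log-likelihood under the variational posterior *)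

Section expected_log_likelihood.
Context {R : realType} {n T : nat}.
Variables (m : 'cV[R]_n) (S : 'M[R]_n) (Sigma : R).
Variables (f : 'I_T -> 'cV[R]_n) (y : 'I_T -> R).
Hypotheses (hS : sym_posdef S) (Sigma_gt0 : 0 < Sigma).
Local Open Scope classical_set_scope.

Let lik (w : 'cV[R]_n) := \prod_(t < T) gauss_pdf ((w^T *m f t) 0 0) Sigma (y t).

Let c := ln (normal_peak (Num.sqrt Sigma)).

(** The squared residual, split into the residual at the mean [m] and a centred linear form, as
    [mvgauss_second_moment] expects. *)
Let res t (w : 'cV[R]_n) :=
  (y t - (m^T *m f t) 0 0 - ((w - m)^T *m f t) 0 0) ^+ 2.

Let resE t w : (y t - (w^T *m f t) 0 0) ^+ 2 = res t w.
Proof.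
rewrite /res -addrA -opprD; congr ((_ - _) ^+ 2).
rewrite -{1}(subrKC m w).
have -> : (m + (w - m))^T = m^T + (w - m)^T by apply/rowP => i; rewrite !mxE.
by rewrite mulmxDl mxE.
Qed.

Lemma lik_gt0 w : 0 < lik w.
Proof. by apply: prodr_gt0 => t _; exact: gauss_pdf_gt0. Qed.

Let ln_likE w : ln (lik w) = \sum_(t < T) (c - (2 * Sigma)^-1 * res t w).
Proof.
rewrite ln_prod; last by move=> t; exact: gauss_pdf_gt0.
by apply: eq_bigr => t _; rewrite ln_gauss_pdf// resE [_ / _]mulrC.
Qed.

Let mres t : measurable_fun [set: n.-tuple (measurableTypeR R)]
  (fun s => res t (col_tuple s) : measurableTypeR R).
Proof.
apply: measurable_funX; apply: measurable_funB => //.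
exact: measurable_affine_tuple.
Qed.

Lemma measurable_lik : measurable_fun [set: n.-tuple (measurableTypeR R)]
  (fun s => lik (col_tuple s) : measurableTypeR R).
Proof.
rewrite /lik; apply: measurable_prod => t _.
under eq_fun do rewrite gauss_pdfE// resE.
apply: measurable_funM => //; apply: measurableT_comp; first exact: measurable_expR.
apply: measurableT_comp; first exact: oppr_measurable.
by apply: measurable_funM; [exact: mres|].
Qed.

Let Q s := mvgauss_pdf m S (col_tuple s).

Let Q_ge0 s : 0 <= Q s.
Proof. by rewrite ltW// mvgauss_pdf_gt0. Qed.

Let mQ : measurable_fun setT Q := measurable_mvgauss_pdf _ _.

(** The squared residual at the mean plus the variance of the linear form. *)
Let V t := (y t - (m^T *m f t) 0 0) ^+ 2 + quadf S (f t).

Let int_res t : (\int[lebesgue_tuple R n]_s (Q s * res t (col_tuple s))%:E <=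
  (V t)%:E)%E.
Proof. exact: mvgauss_second_moment. Qed.

Let integrable_res t :
  (lebesgue_tuple R n).-integrable setT
    (fun s => (Q s * res t (col_tuple s))%:E).
Proof.
apply/integrableP; split.
  by apply/measurable_EFinP; apply: measurable_funM; [exact: mQ|exact: mres].
under eq_integral do rewrite gee0_abs ?lee_fin ?(mulr_ge0 (Q_ge0 _) (sqr_ge0 _))//.
exact: le_lt_trans (int_res t) (ltry _).
Qed.

Let integrable_Q : (lebesgue_tuple R n).-integrable setT (fun s => (Q s)%:E).
Proof.
apply/integrableP; split; first exact/measurable_EFinP.
under eq_integral do rewrite gee0_abs ?lee_fin//.
by rewrite integral_mvgauss_pdf// ltry.
Qed.

(** One summand of the weighted log-likelihood, written as a combination of two integrable functions
    so that linearity of the integral applies. *)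
Let term t s := (c%:E * (Q s)%:E +
  (- (2 * Sigma)^-1)%:E * (Q s * res t (col_tuple s))%:E)%E.

Let integrable_term t : (lebesgue_tuple R n).-integrable setT (term t).
Proof. by apply: integrableD => //; exact: integrableZl. Qed.

Let Q_ln_likE s : ((Q s * ln (lik (col_tuple s)))%:E = \sum_(t < T) term t s)%E.
Proof.
rewrite ln_likE mulr_sumr -sumEFin; apply: eq_bigr => t _.
by rewrite /term -!EFinM -EFinD; congr _%:E; ring.
Qed.

Lemma integrable_log_lik : (lebesgue_tuple R n).-integrable setT
  (fun s => (mvgauss_pdf m S (col_tuple s) * ln (lik (col_tuple s)))%:E).
Proof.
apply: (eq_integrable _ (fun s => \sum_(t < T) term t s)%E) => //.
  by move=> s _; rewrite -Q_ln_likE.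
exact: integrable_sum.
Qed.

Lemma integral_log_lik_ge :
  ((\sum_(t < T) (ln (gauss_pdf ((m^T *m f t) 0 0) Sigma (y t))
     - 2^-1 * quadf S (f t) * Sigma^-1))%:E <=
  \int[lebesgue_tuple R n]_s
    (mvgauss_pdf m S (col_tuple s) * ln (lik (col_tuple s)))%:E)%E.
Proof.
under eq_integral do rewrite Q_ln_likE.
rewrite integral_sum// -sumEFin; apply: lee_sum => t _.
rewrite integralD//; [|exact: integrableZl..].
rewrite !integralZl// integral_mvgauss_pdf// mule1.
have -> : ln (gauss_pdf ((m^T *m f t) 0 0) Sigma (y t)) -
    2^-1 * quadf S (f t) * Sigma^-1 = c + - (2 * Sigma)^-1 * V t.
  by rewrite ln_gauss_pdf// /c /V; field; rewrite gt_eqF.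
(* The negative coefficient turns the upper bound [int_res] into a lower bound. *)
rewrite EFinD leeD2l// EFinM !EFinN !mulNe leeN2.
by apply: lee_wpmul2l (int_res t); rewrite lee_fin invr_ge0 mulr_ge0// ltW.
Qed.

End expected_log_likelihood.

(** * The evidence lower bound for the Bayesian last layer *)

Theorem theorem1 (R : realType) (Nx Nphi T : nat) (Theta : Type)
    (phi : 'cV[R]_Nx -> Theta -> 'cV[R]_Nphi)
    (x : 'I_T -> 'cV[R]_Nx) (y : 'I_T -> R) (theta : Theta)
    (wbar0 : 'cV[R]_Nphi) (S0 : 'M[R]_Nphi) (Sigma : R)
    (wbar : 'cV[R]_Nphi) (S : 'M[R]_Nphi)
    (hT : (0 < T)%N) (hS0 : sym_posdef S0) (hS : sym_posdef S)
    (hSigma : 0 < Sigma) :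
  ((T%:R^-1)%:E *
     lne (marginal_likelihood phi (mvgauss_pdf wbar0 S0) Sigma x theta y)
   >= (vbll_objective phi x y theta wbar S Sigma)%:E
      - (T%:R^-1)%:E * kl_pdf (mvgauss_pdf wbar S) (mvgauss_pdf wbar0 S0))%E.
Proof.
pose f t := phi (x t) theta.
pose A := \sum_(t < T) (ln (gauss_pdf ((wbar^T *m f t) 0 0) Sigma (y t))
     - 2^-1 * quadf S (f t) * Sigma^-1).
have q0 s := mvgauss_pdf_gt0 wbar S hS (col_tuple s).
have p0 s := mvgauss_pdf_gt0 wbar0 S0 hS0 (col_tuple s).
(* Both densities are positive everywhere, so the branches of [kl_pdf] for vanishing densities never
   occur. *)
have klE : kl_pdf (mvgauss_pdf wbar S) (mvgauss_pdf wbar0 S0) =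
    (\int[lebesgue_tuple R Nphi]_s (mvgauss_pdf wbar S (col_tuple s) *
      ln (mvgauss_pdf wbar S (col_tuple s) /
          mvgauss_pdf wbar0 S0 (col_tuple s)))%:E)%E.
  by apply: eq_integral => s _; rewrite /= !gt_eqF.
have bound := variational_bound (lebesgue_tuple R Nphi) _ _ _ A q0 p0
  (fun s => lik_gt0 Sigma f y hSigma (col_tuple s))
  (measurable_mvgauss_pdf wbar S) (measurable_mvgauss_pdf wbar0 S0)
  (measurable_lik wbar Sigma f y hSigma) (integral_mvgauss_pdf wbar S hS)
  (integrable_log_lik wbar S Sigma f y hS hSigma)
  (integral_log_lik_ge wbar S Sigma f y hS hSigma).
rewrite -klE in bound.
have T0 : 0 <= (T%:R^-1 : R) by rewrite invr_ge0.
have -> : vbll_objective phi x y theta wbar S Sigma = T%:R^-1 * A by [].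
(* As [A] is finite, the difference is well defined and the factor distributes over it even if the
   divergence is infinite. *)
rewrite EFinM -muleBr//.
by apply: lee_wpmul2l bound; rewrite lee_fin.
Qed.
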